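(* Let $X$ be a Banach space and let $A\subseteq \mathcal{B}(X)$ be a norm-closed subalgebra. Suppose that $A$ is bicontinuously isomorphic (as an algebra) to a quasi-directly finite $C^*$-algebra. Then $A$ is surjunctive, i.e. for every $a\in A$ the residual spectrum of $a$ is empty.
   Context: $\mathcal{B}(X)$ denotes the algebra of bounded linear operators on $X$. For $T\in\mathcal{B}(X)$, the residual spectrum of $T$ is the set of $\lambda\in\mathbb{C}$ such that $T-\lambda I$ is injective with closed range that is a proper subspace of $X$. A subalgebra $A\subseteq\mathcal{B}(X)$ is called surjunctive if every $a\in A$ has empty residual spectrum. For elements $a,b$ of a ring $R$ (not necessarily unital), put $a\diamond b := a+b-ab$; if $a\diamond b=0$, $a$ is called a left quasi-inverse of $b$ and $b$ a right quasi-inverse of $a$. A ring $R$ is quasi-directly finite if every element of $R$ which has a left quasi-inverse in $R$ also has a right quasi-inverse in $R$ (equivalently: whenever $a,b\in R$ satisfy $a\diamond b=0$, also $b\diamond a=0$). An algebra is quasi-directly finite if its underlying ring is. *)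

(* Defs.v *)
From HB Require Import structures.
From mathcomp Require Import all_boot all_order all_algebra.
From mathcomp Require Import all_classical all_reals all_analysis.
From mathcomp Require Export complex.
Export Order.TTheory GRing.Theory Num.Theory.
Export numFieldNormedType.Exports.

Set Implicit Arguments.
Unset Strict Implicit.
Unset Printing Implicit Defensive.

Local Open Scope ring_scope.
Local Open Scope classical_set_scope.

Section Defs.
Context {R : realType}.
Local Notation C := (R[i]).

Section Operators.
Context {X : completeNormedModType C}.

Definition bounded_op (T : X -> X) : Prop :=
  (forall (a : C) (u v : X), T (a *: u + v) = a *: T u + T v) /\ continuous T.

(* operator-norm distance:  ||S - T|| < d  (the operator norm is the
   infimum of the admissible bounds M, and the infimum is attained) *)
Definition opdist_lt (S T : X -> X) (d : C) : Prop :=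
  exists M : C, 0 <= M /\ M < d /\ forall x : X, `|S x - T x| <= M * `|x|.

Definition subalgebra_BX (A : set (X -> X)) : Prop :=
  [/\ forall T, A T -> bounded_op T,
      A (fun _ => 0),
      forall S T, A S -> A T -> A (fun x => S x + T x),
      forall (a : C) T, A T -> A (fun x => a *: T x)
    & forall S T, A S -> A T -> A (S \o T)].

Definition norm_closed (A : set (X -> X)) : Prop :=
  forall T, bounded_op T ->
    (forall e : C, 0 < e -> exists2 S, A S & opdist_lt S T e) -> A T.

Definition residual_spectrum (T : X -> X) : set C :=
  [set lambda | let Tl := (fun x : X => T x - lambda *: x) in
     [/\ injective Tl, closed (range Tl) & range Tl <> setT]].

Definition surjunctive (A : set (X -> X)) : Prop :=
  forall T, A T -> residual_spectrum T = set0.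
End Operators.

Definition is_Cstar_algebra (B : completeNormedModType C)
    (mul : B -> B -> B) (star : B -> B) : Prop :=
  (forall (a : C) x y z, mul (a *: x + y) z = a *: mul x z + mul y z) /\
      (forall (a : C) x y z, mul x (a *: y + z) = a *: mul x y + mul x z) /\
      (forall x y z, mul x (mul y z) = mul (mul x y) z) /\
      (forall x y, `|mul x y| <= `|x| * `|y|) /\
      (forall (a : C) x y, star (a *: x + y) = a^* *: star x + star y) /\
      (forall x, star (star x) = x) /\
      (forall x y, star (mul x y) = mul (star y) (star x))
  /\ (forall x, `|mul (star x) x| = `|x| ^+ 2).

Definition qprod {B : zmodType} (mul : B -> B -> B) (a b : B) : B :=
  a + b - mul a b.

Definition quasi_directly_finite {B : zmodType} (mul : B -> B -> B) : Prop :=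
  forall a : B, (exists b, qprod mul b a = 0) -> (exists c, qprod mul a c = 0).

Definition bicont_alg_iso {X : completeNormedModType C}
    (A : set (X -> X)) (B : completeNormedModType C) (mul : B -> B -> B)
    (phi : (X -> X) -> B) : Prop :=
  {in A &, injective phi} /\
      (forall b : B, exists2 T, A T & phi T = b) /\
      (forall S T, A S -> A T -> phi (fun x => S x + T x) = phi S + phi T) /\
      (forall (a : C) T, A T -> phi (fun x => a *: T x) = a *: phi T) /\
      (forall S T, A S -> A T -> phi (S \o T) = mul (phi S) (phi T)) /\
      (forall T, A T -> forall e : C, 0 < e -> exists2 d : C, 0 < d &
         forall S, A S -> opdist_lt S T d -> `|phi S - phi T| < e) /\
      (forall T, A T -> forall e : C, 0 < e -> exists2 d : C, 0 < d &
         forall S, A S -> `|phi S - phi T| < d -> opdist_lt S T e).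
End Defs.

(* Main.v *)
(** Suppose [T - a] is injective with closed range. By the open mapping theorem
    it is bounded below, hence so is left multiplication by [b - a] on the
    C*-algebra [B], where [b] is the image of [T]. By the C*-identity, so is left
    multiplication [K] by the selfadjoint element [(b - a)^* (b - a)].
    Arens' trick makes [K + is] surjective on [B] for real [s > 0], and
    letting [s] be small compared with the lower bound of [K] shows that [K] itself
    is surjective. Solving one linear equation in [B] then yields a left
    (quasi-)inverse of [b - a]; direct finiteness makes it two-sided, so [T - a]
    is onto. All operators act on [B] itself, so that neither the unitization
    of [B] nor a functional calculus is needed. *)

Require Import Defs.
From HB Require Import structures.
From mathcomp Require Import all_boot all_order all_algebra.
From mathcomp Require Import all_classical all_reals all_analysis.
From mathcomp Require Import complex ring lra.
Import Order.TTheory GRing.Theory Num.Theory.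
Import numFieldNormedType.Exports.
Local Open Scope ring_scope.
Local Open Scope classical_set_scope.
Local Open Scope complex_scope.

Set Implicit Arguments.
Unset Strict Implicit.

(** * Real-valued norms and geometric convergence *)

Section RealNorm.
Context {R : realType} {V : normedModType R[i]}.
Implicit Types (u v w : V) (e r : R).

(** The norm lives in [R[i]], whose order is only partial; passing to its real part loses nothing
    and gives access to real arithmetic. *)
Definition rnorm v : R := complex.Re `|v|.

Lemma rnormE v : `|v| = (rnorm v)%:C.
Proof. by rewrite /rnorm RRe_real // normr_real. Qed.

Lemma rnorm_ge0 v : 0 <= rnorm v.
Proof. by rewrite -lecR -rnormE normr_ge0. Qed.

Lemma rnorm0 : rnorm 0 = 0.
Proof. by apply: complexI; rewrite -rnormE normr0. Qed.

Lemma rnorm_eq0 v : rnorm v = 0 -> v = 0.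
Proof. by move=> v0; apply/eqP; rewrite -normr_eq0 rnormE v0. Qed.

Lemma rnormN v : rnorm (- v) = rnorm v.
Proof. by rewrite /rnorm normrN. Qed.

Lemma rnormBC u v : rnorm (u - v) = rnorm (v - u).
Proof. by rewrite -rnormN opprB. Qed.

Lemma rnormD u v : rnorm (u + v) <= rnorm u + rnorm v.
Proof. by rewrite -lecR rmorphD /= -!rnormE ler_normD. Qed.

Lemma rnormB u v : rnorm (u - v) <= rnorm u + rnorm v.
Proof. by rewrite -(rnormN v); apply: rnormD. Qed.

Lemma rnorm_trans w u v : rnorm (u - v) <= rnorm (u - w) + rnorm (w - v).
Proof. by have := rnormD (u - w) (w - v); rewrite addrA subrK. Qed.

Lemma rnormZ (a : R[i]) v : rnorm (a *: v) = complex.Re `|a| * rnorm v.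
Proof.
apply: complexI.
by rewrite rmorphM /= -!rnormE normrZ; congr (_ * _).
Qed.

Lemma rnormZr r v : rnorm (r%:C *: v) = `|r| * rnorm v.
Proof.
rewrite rnormZ; congr (_ * _).
by rewrite normc_def /= expr0n addr0 sqrtr_sqr.
Qed.

Lemma gt0_complexE (e : R[i]) : 0 < e -> e = (complex.Re e)%:C /\ 0 < complex.Re e.
Proof. by case: e => a b; rewrite ltcE /= => /andP[/eqP -> ->]. Qed.

Lemma closed_rnormP (A : set V) v : closed A ->
  (forall e, 0 < e -> exists2 w, A w & rnorm (w - v) < e) -> A v.
Proof.
move=> clA approx; apply: clA => U /nbhs_normP[e /= e0 vU].
have [eE re0] := gt0_complexE e0.
have [w Aw wv] := approx _ re0.
exists w; split=> //; apply: vU => /=.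
by rewrite eE rnormE ltcR rnormBC.
Qed.

End RealNorm.

Lemma geometric_lt {R : realType} (c q e : R) : 0 <= q -> q < 1 -> 0 < e ->
  exists n, forall m, (n <= m)%N -> c * q ^+ m < e.
Proof.
move=> q0 q1 e0; have := @cvg_geometric R c q.
rewrite ger0_norm // => /(_ q1) /cvgrPdist_lt /(_ _ e0) [n _ hn].
exists n => m /hn; rewrite /geometric /= sub0r normrN.
by apply: le_lt_trans; apply: ler_norm.
Qed.

Lemma rnorm_le_geometric {R : realType} {V : normedModType R[i]} (v : V) (c q : R) :
  0 <= q -> q < 1 -> (forall n, rnorm v <= c * q ^+ n) -> v = 0.
Proof.
move=> q0 q1 hv; apply: rnorm_eq0; apply/eqP; rewrite eq_le rnorm_ge0 andbT.
apply/ler_addgt0Pr => e /(geometric_lt c q0 q1)[n /(_ n (leqnn n)) hn].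
by rewrite add0r; apply: le_trans (hv n) (ltW hn).
Qed.

(** Summing the steps gives the tail bound c (q^n - q^(n+m)) / (1 - q), so the sequence is Cauchy.
    The explicit rate is kept because its value at n = 0 yields a lower bound for operators later
    on. *)
Lemma geometric_cvg {R : realType} (V : completeNormedModType R[i])
    (u : nat -> V) (c q : R) : 0 <= q -> q < 1 ->
    (forall n, rnorm (u n.+1 - u n) <= c * q ^+ n) ->
  exists l, forall n, rnorm (l - u n) <= c / (1 - q) * q ^+ n.
Proof.
move=> q0 q1 hu.
have p1 : 0 < 1 - q by lra.
have c0 : 0 <= c.
  by have := le_trans (rnorm_ge0 _) (hu 0%N); rewrite expr0 mulr1.
have tail m n : rnorm (u (n + m)%N - u n) <= c / (1 - q) * (q ^+ n - q ^+ (n + m)).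
  elim: m => [|m IH]; first by rewrite addn0 !subrr rnorm0 mulr0.
  apply: le_trans (rnorm_trans (u (n + m)%N) _ _) _.
  rewrite addnS; apply: le_trans (lerD (hu _) IH) _.
  rewrite le_eqVlt; apply/orP; left; apply/eqP.
  rewrite [q ^+ (n + m).+1]exprS; field; lra.
have tail' n m : (n <= m)%N -> rnorm (u m - u n) <= c / (1 - q) * q ^+ n.
  move=> nm; rewrite -(subnKC nm); apply: le_trans (tail _ _) _.
  by rewrite ler_wpM2l ?divr_ge0 ?(ltW p1)// lerBlDr lerDl exprn_ge0.
have : cvg (u @ \oo).
  apply: cauchy_cvg; apply: cauchy_exP => e e0.
  have [eE re0] := gt0_complexE e0.
  have [n /(_ n (leqnn n)) hn] := geometric_lt (c / (1 - q)) q0 q1 re0.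
  exists (u n), n => // m /= nm.
  rewrite -ball_normE /= eE rnormE ltcR rnormBC.
  exact: le_lt_trans (tail' _ _ nm) hn.
move=> /cvg_ex[l /cvgrPdist_lt ul].
exists l => n; apply/ler_addgt0Pr => e e0.
have e0' : 0 < e%:C :> R[i] by rewrite ltcR.
have [k _ hk] := ul _ e0'.
have := hk (maxn n k) (leq_maxr _ _); rewrite /= rnormE ltcR => lk.
apply: le_trans (rnorm_trans (u (maxn n k)) _ _) _.
rewrite addrC; apply: lerD; [exact: tail' (leq_maxl _ _) | exact: ltW].
Qed.

(** * Injective operators with closed range *)

Lemma continuous_rnorm_bounded {R : realType} {V W : normedModType R[i]}
    (S : {linear V -> W}) : continuous S ->
  exists2 m : R, 0 < m & forall v, rnorm (S v) <= m * rnorm v.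
Proof.
have lt01 : 0 < (1 : R)%:C by rewrite ltcR.
move=> /(_ 0)/cvgrPdist_lt/(_ _ lt01); rewrite linear0 {lt01}.
move=> /nbhs_normP[d /= /gt0_complexE[dE d0] hd].
set r := complex.Re d in dE d0.
exists (2 / r) => [|v]; first by rewrite divr_gt0.
have [v0|v_neq0] := eqVneq (rnorm v) 0.
  by rewrite (rnorm_eq0 v0) linear0 !rnorm0 mulr0.
have v_gt0 : 0 < rnorm v by rewrite lt_def v_neq0 rnorm_ge0.
have s0 : 0 < r / (2 * rnorm v) by rewrite divr_gt0 // mulr_gt0.
have h : r / (2 * rnorm v) * rnorm (S v) < 1.
  have := hd ((r / (2 * rnorm v))%:C *: v).
  rewrite /= !sub0r !normrN {}dE !rnormE linearZ /= !rnormZr (gtr0_norm s0).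
  rewrite !ltcR.
  apply; suff -> : r / (2 * rnorm v) * rnorm v = r / 2 by lra.
  by field; lra.
rewrite mulrAC ler_pdivlMr //.
move: h; rewrite mulrAC ltr_pdivrMr ?mulr_gt0 // mul1r => /ltW.
by rewrite mulrC.
Qed.

Section OpenMapping.
Context {R : realType} {V W : completeNormedModType R[i]}.
Variable S : {linear V -> W}.
Hypothesis S_closed : closed (range S).

(* Baire's argument in the complete space [range S], which the images of the
   balls of radius [k] cover. *)
Lemma somewhere_dense_ball_image : exists (k : nat) (v0 : V) (r : R), 0 < r /\
  forall v, rnorm (S v - S v0) < r -> forall e, 0 < e ->
    exists2 z, rnorm z <= k%:R & rnorm (S z - S v) < e.
Proof.
apply: contrapT => no_ball.
(* If the claim fails, every ball around a point of the range contains a ball of at most half the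
   radius, again centred in the range, which misses the image of the [k]-ball. Positivity of the
   radius is a premise inside the existential so that [choice] gives a total function. *)
have step (k : nat) (p : V * R) : exists p' : V * R, 0 < p.2 ->
    [/\ 0 < p'.2, p'.2 <= p.2 / 2, rnorm (S p'.1 - S p.1) + p'.2 <= p.2 &
        forall z, rnorm z <= k%:R -> p'.2 < rnorm (S z - S p'.1)].
  case: p => v0 r /=; have [r0|r0] := ltP 0 r; last first.
    by exists (0, 0) => r0'; lra.
  apply: contrapT => no_p; apply: no_ball; exists k, v0, r; split=> // v vr e e0.
  apply: contrapT => no_z; apply: no_p.
  set t := r - rnorm (S v - S v0).
  have t0 : 0 < t by rewrite /t; lra.
  have tr : t <= r by rewrite /t; have := rnorm_ge0 (S v - S v0); lra.
  (* The slack [t] keeps the new ball inside the old one; the bound [e / 2] stays strictly below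
     [e], so even the closed ball misses the image. *)
  exists (v, Num.min (t / 2) (e / 2)) => _ /=.
  have le1 : Num.min (t / 2) (e / 2) <= t / 2 by rewrite ge_min lexx.
  have le2 : Num.min (t / 2) (e / 2) <= e / 2 by rewrite ge_min lexx orbT.
  split; first by rewrite lt_min; apply/andP; split; lra.
  - by lra.
  - by rewrite -lerBrDl; apply: le_trans le1 _; rewrite -/t; lra.
  - move=> z zk; rewrite ltNge; apply/negP => h; apply: no_z.
    by exists z => //; lra.
have {}step (kp : nat * (V * R)) := step kp.1 kp.2.
have [f fP] := choice step.
pose p := fix p n := if n is m.+1 then f (m, p m) else (0, 1).
have p0 n : 0 < (p n).2.
  elim: n => [|n IH] /=; first exact: ltr01.
  by have [] := fP (n, p n) IH.
have {fP} pP n := fP (n, p n) (p0 n).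
pose v n := (p n).1; pose r n := (p n).2.
have rB n : rnorm (S (v n.+1) - S (v n)) + r n.+1 <= r n by have [] := pP n.
have r2 n : r n <= 2^-1 ^+ n.
  elim: n => [|n IH]; first by rewrite expr0.
  have [_ + _ _] := pP n; rewrite -/(p n.+1) exprSr => /= h.
  by apply: le_trans h _; rewrite ler_pM2r // invr_gt0.
have step_le n : rnorm (S (v n.+1) - S (v n)) <= 1 * 2^-1 ^+ n.
  rewrite mul1r; apply: le_trans (r2 n); have := rB n.
  by have := p0 n.+1; rewrite -/(r n.+1); lra.
have [y yP] := geometric_cvg (u := fun n => S (v n)) (c := 1) (q := 2^-1)
  ltac:(lra) ltac:(lra) step_le.
have small e : 0 < e -> exists n, forall m, (n <= m)%N -> rnorm (y - S (v m)) < e.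
  move=> /(geometric_lt (q := 2^-1) (1 / (1 - 2^-1)) ltac:(lra) ltac:(lra))[n hn].
  by exists n => m /hn; apply: le_lt_trans.
have vB n m : rnorm (S (v (n + m)%N) - S (v n)) + r (n + m)%N <= r n.
  elim: m => [|m IH]; first by rewrite addn0 subrr rnorm0 add0r.
  rewrite addnS; have := rnorm_trans (S (v (n + m)%N)) (S (v (n + m).+1)) (S (v n)).
  by have := rB (n + m)%N; lra.
have yB n : rnorm (y - S (v n)) <= r n.
  apply/ler_addgt0Pr => e e0; have [m /(_ (n + m)%N (leq_addl _ _)) hm] := small e e0.
  have := rnorm_trans (S (v (n + m)%N)) y (S (v n)).
  have := vB n m; have := p0 (n + m)%N; rewrite -/(r (n + m)%N); lra.
(* The limit of the centres lies in the closed range, so it is [S x] with [x] in some [n]-ball; but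
   the ball chosen at stage [n] contains the limit and misses the image of that [n]-ball. *)
have [x _ xy] : range S y.
  apply: closed_rnormP S_closed _ => e e0; have [n /(_ n (leqnn n)) hn] := small e e0.
  by exists (S (v n)); [exists (v n) | rewrite rnormBC].
have [n xn] : exists n : nat, rnorm x <= n%:R.
  by exists (Num.bound (rnorm x)); apply/ltW/archi_boundP/rnorm_ge0.
have [_ _ _ /(_ x xn)] := pP n; rewrite xy -/(p n.+1) ltNge => /negP; apply.
exact: yB.
Qed.

(** Scale [v] by [t] so that [S (v0 + t v)] is at distance r / 2 from [S v0]. Both points are within
    r / 8 of images of the [n]-ball; subtracting the two approximants and dividing by [t] gives [z],
    with error at most (r / 4) / t, half the norm of [S v]. *)
Lemma approximate_preimage : exists2 k : R, 0 <= k & forall v,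
  exists2 z, rnorm z <= k * rnorm (S v) & rnorm (S (v - z)) <= rnorm (S v) / 2.
Proof.
have [n [v0 [r [r0 dense]]]] := somewhere_dense_ball_image.
exists (4 * n%:R / r) => [|v].
  by rewrite divr_ge0 ?mulr_ge0 ?ler0n // ltW.
have [Sv0|Sv_neq0] := eqVneq (rnorm (S v)) 0.
  by exists 0; rewrite ?subr0 ?rnorm0 Sv0 ?mulr0 ?mul0r.
have Sv_gt0 : 0 < rnorm (S v) by rewrite lt_def Sv_neq0 rnorm_ge0.
pose t := r / (2 * rnorm (S v)).
have t0 : 0 < t by rewrite divr_gt0 // mulr_gt0.
have [|z1 z1n hz1] := dense (v0 + t%:C *: v) _ (r / 8) ltac:(lra).
  rewrite linearD addrAC subrr add0r linearZ /= rnormZr gtr0_norm //.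
  have -> : t * rnorm (S v) = r / 2 by rewrite /t; field; lra.
  by lra.
have [|z2 z2n hz2] := dense v0 _ (r / 8) ltac:(lra); first by rewrite subrr rnorm0.
exists (t^-1%:C *: (z1 - z2)).
  rewrite rnormZr gtr0_norm ?invr_gt0 //.
  have -> : 4 * n%:R / r * rnorm (S v) = t^-1 * (2 * n%:R).
    by rewrite /t; field; lra.
  rewrite ler_wpM2l ?invr_ge0 ?(ltW t0) //.
  by apply: le_trans (rnormB _ _) _; lra.
have tv : v = t^-1%:C *: (t%:C *: v).
  by rewrite scalerA -rmorphM /= mulVf ?scale1r // gt_eqF.
rewrite {1}tv -scalerBr linearZ /= rnormZr gtr0_norm ?invr_gt0 //.
have -> : rnorm (S v) / 2 = t^-1 * (r / 4) by rewrite /t; field; lra.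
rewrite ler_wpM2l ?invr_ge0 ?(ltW t0) //.
have -> : S (t%:C *: v - (z1 - z2)) =
    (S z2 - S v0) - (S z1 - S (v0 + t%:C *: v)).
  rewrite -!linearB; congr (S _).
  by rewrite !opprB [RHS]addrA [z2 - v0 + _]addrA subrK addrA [z2 + _]addrC.
by apply: le_trans (rnormB _ _) _; lra.
Qed.

(** Subtracting approximate preimages repeatedly from [v] gives [w n] with [S (w n)] tending to 0
    and [w n] converging to some [l]. Then [S l = 0], so [l = 0] by injectivity, and the total
    correction bounds [v] by 2k times the norm of [S v]. *)
Lemma injective_closed_range_bounded_below : injective S -> continuous S ->
  exists2 d : R, 0 < d & forall v, d * rnorm v <= rnorm (S v).
Proof.
move=> injS contS; have [m m0 Sm] := continuous_rnorm_bounded contS.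
have [k k0 /choice[z' zP]] : exists2 k : R, 0 <= k & forall v, exists z,
    rnorm z <= k * rnorm (S v) /\ rnorm (S (v - z)) <= rnorm (S v) / 2.
  have [k k0 h] := approximate_preimage.
  by exists k => // v; have [z ? ?] := h v; exists z.
(* The geometric series contributes [2 * k]; adding 1 keeps the constant invertible when [k] is
   0. *)
exists (2 * k + 1)^-1 => [|v]; first by rewrite invr_gt0; lra.
pose w n := iter n (fun x => x - z' x) v.
have Sw n : rnorm (S (w n)) <= rnorm (S v) * 2^-1 ^+ n.
  elim: n => [|n IH]; first by rewrite expr0 mulr1.
  have [_ /= h] := zP (w n); apply: le_trans h _.
  by rewrite exprSr mulrA ler_pM2r // invr_gt0.
have wB n : rnorm (w n.+1 - w n) <= k * rnorm (S v) * 2^-1 ^+ n.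
  rewrite /= addrAC subrr add0r rnormN; have [h _] := zP (w n).
  by apply: le_trans h _; rewrite -mulrA ler_wpM2l.
have [l lP] := geometric_cvg (u := w) (c := k * rnorm (S v)) (q := 2^-1)
  ltac:(lra) ltac:(lra) wB.
pose c := m * (k * rnorm (S v) / (1 - 2^-1)) + rnorm (S v).
have Sl n : rnorm (S l) <= c * 2^-1 ^+ n.
  have -> : l = (l - w n) + w n by rewrite subrK.
  rewrite linearD; apply: le_trans (rnormD _ _) _.
  rewrite /c mulrDl lerD //; apply: le_trans (Sm _) _.
  by rewrite -mulrA ler_wpM2l // ltW.
have Sl0 : S l = 0.
  by apply: (rnorm_le_geometric (c := c) (q := 2^-1)) Sl; lra.
have l0 : l = 0 by apply: injS; rewrite Sl0 linear0.
have := lP 0%N; rewrite l0 sub0r rnormN /= expr0 mulr1 => h.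
rewrite mulrC ler_pdivrMr; last by lra.
have -> : rnorm (S v) * (2 * k + 1) = k * rnorm (S v) / (1 - 2^-1) + rnorm (S v).
  by field; lra.
by have := rnorm_ge0 (S v); lra.
Qed.

End OpenMapping.

(** * Left multiplication operators on a C*-algebra *)

(** Banach's fixed point argument: with [g] a right inverse of [U], the map sending [v] to
    [g (y - P v)] contracts by p / m because [U] is bounded below by [m], and its fixed point solves
    the equation. *)
Lemma surjective_perturbation {R : realType} {V : completeNormedModType R[i]}
    (U P : {linear V -> V}) (m p : R) : 0 <= p -> p < m ->
    (forall v, m * rnorm v <= rnorm (U v)) -> (forall y, exists v, U v = y) ->
    (forall v, rnorm (P v) <= p * rnorm v) ->
  forall y, exists v, U v + P v = y.
Proof.
move=> p0 pm Um /choice[g gK] Pp y.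
have m0 : 0 < m by lra.
pose F v := g (y - P v).
have FB v w : rnorm (F v - F w) <= p / m * rnorm (v - w).
  rewrite mulrAC ler_pdivlMr // mulrC; apply: le_trans (Um _) _.
  rewrite linearB !gK /F opprB addrC addrA subrK -linearB.
  by rewrite (rnormBC v); apply: Pp.
pose u n := iter n F 0.
have q0 : 0 <= p / m by rewrite divr_ge0 // ltW.
have q1 : p / m < 1 by rewrite ltr_pdivrMr // mul1r.
have uB n : rnorm (u n.+1 - u n) <= rnorm (F 0) * (p / m) ^+ n.
  elim: n => [|n IH]; first by rewrite /= subr0 expr0 mulr1.
  apply: le_trans (FB _ _) _.
  by rewrite exprS mulrCA ler_wpM2l.
have [l lP] := geometric_cvg q0 q1 uB.
(* Both [F l] and [l] are within a geometric error of [u n.+1]. *)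
have Fl : F l - l = 0.
  set c := _ / _ in lP; apply: (@rnorm_le_geometric _ _ _ (c + c) _ q0 q1) => n.
  have h1 := FB l (u n); have h2 := lP n; have h3 := lP n.+1.
  have h4 := rnorm_trans (u n.+1) (F l) l.
  have h5 : p / m * rnorm (l - u n) <= rnorm (l - u n) by rewrite ler_piMl ?rnorm_ge0 // ltW.
  have c0 : 0 <= c * (p / m) ^+ n by apply: le_trans (rnorm_ge0 _) h2.
  have h6 : c * (p / m) ^+ n.+1 <= c * (p / m) ^+ n.
    by rewrite exprS mulrCA ler_piMl // ltW.
  rewrite (rnormBC (u n.+1)) in h4; rewrite mulrDl.
  apply: le_trans h4 _; apply: lerD; first exact: le_trans h1 (le_trans h5 h2).
  exact: le_trans h3 h6.
exists l; have -> : U l = U (F l) by congr (U _); apply/esym/eqP; rewrite -subr_eq0 Fl.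
by rewrite gK subrK.
Qed.

(** Choosing [t] with m^2 = 2st makes (s + t)^2 exceed m^2 + t^2 by exactly s^2. *)
Lemma sqr_add_lt_sqr {R : realType} (m s : R) : 0 < s -> exists t p : R,
  [/\ 0 < s + t, 0 <= p, p < s + t & p ^+ 2 = m ^+ 2 + t ^+ 2].
Proof.
move=> s0; pose t := m ^+ 2 / (2 * s).
have t0 : 0 <= t by rewrite divr_ge0 ?sqr_ge0 // mulr_ge0 // ltW.
have mt : m ^+ 2 = 2 * s * t by rewrite /t; field; lra.
have p2 : Num.sqrt (m ^+ 2 + t ^+ 2) ^+ 2 = m ^+ 2 + t ^+ 2.
  by rewrite sqr_sqrtr // addr_ge0 ?sqr_ge0.
exists t, (Num.sqrt (m ^+ 2 + t ^+ 2)); split=> //; first by lra.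
rewrite -(@ltr_pXn2r _ 2) ?nnegrE ?sqrtr_ge0 //; last by lra.
by rewrite p2 mt; nra.
Qed.

Definition linear_of {R : realType} {V W : lmodType R[i]} (f : V -> W)
    (hf : linear f) : {linear V -> W} :=
  HB.pack f (GRing.isLinear.Build R[i] V W *:%R f hf).

Section Cstar.
Context {R : realType} {B : completeNormedModType R[i]}.
Context {mul : B -> B -> B} {star : B -> B}.
Hypothesis Cstar : is_Cstar_algebra mul star.
Local Notation "x ** y" := (mul x y) (at level 40, left associativity).

Lemma cmulA x y z : x ** (y ** z) = x ** y ** z.
Proof. by case: Cstar => _ [_] []. Qed.

Lemma cmulDl x y z : (x + y) ** z = x ** z + y ** z.
Proof. by case: Cstar => + _ => /(_ 1 x y z); rewrite !scale1r. Qed.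

Lemma cmulDr x y z : x ** (y + z) = x ** y + x ** z.
Proof. by case: Cstar => _ [+ _] => /(_ 1 x y z); rewrite !scale1r. Qed.

Lemma cmul0x x : 0 ** x = 0.
Proof. by apply: (addrI (0 ** x)); rewrite -cmulDl !addr0. Qed.

Lemma cmulx0 x : x ** 0 = 0.
Proof. by apply: (addrI (x ** 0)); rewrite -cmulDr !addr0. Qed.

Lemma cmulZl a x y : (a *: x) ** y = a *: (x ** y).
Proof. by case: Cstar => + _ => /(_ a x 0 y); rewrite cmul0x !addr0. Qed.

Lemma cmulZr a x y : x ** (a *: y) = a *: (x ** y).
Proof. by case: Cstar => _ [+ _] => /(_ a x y 0); rewrite cmulx0 !addr0. Qed.

Lemma cmulNl x y : (- x) ** y = - (x ** y).
Proof. by rewrite -scaleN1r cmulZl scaleN1r. Qed.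

Lemma cmulNr x y : x ** (- y) = - (x ** y).
Proof. by rewrite -scaleN1r cmulZr scaleN1r. Qed.

Lemma starK x : star (star x) = x.
Proof. by case: Cstar => _ [_] [_] [_] [_] []. Qed.

Lemma starM x y : star (x ** y) = star y ** star x.
Proof. by case: Cstar => _ [_] [_] [_] [_] [_] []. Qed.

Lemma starD x y : star (x + y) = star x + star y.
Proof.
by case: Cstar => _ [_] [_] [_] [/(_ 1 x y) + _]; rewrite conjC1 !scale1r.
Qed.

Lemma star0 : star 0 = 0.
Proof. by apply: (addrI (star 0)); rewrite -starD !addr0. Qed.

Lemma starZ a x : star (a *: x) = a^*%C *: star x.
Proof.
by case: Cstar => _ [_] [_] [_] [/(_ a x 0) + _]; rewrite star0 !addr0.
Qed.

Lemma starN x : star (- x) = - star x.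
Proof. by apply: (addrI (star x)); rewrite -starD !subrr star0. Qed.

Lemma cnormM x y : rnorm (x ** y) <= rnorm x * rnorm y.
Proof.
by case: Cstar => _ [_] [_] [/(_ x y) + _]; rewrite !rnormE -rmorphM lecR.
Qed.

Lemma cnorm_sqr x : rnorm (star x ** x) = rnorm x ^+ 2.
Proof.
case: Cstar => _ [_] [_] [_] [_] [_] [_] /(_ x); rewrite !rnormE -rmorphXn.
exact: complexI.
Qed.

(** The C*-identity and submultiplicativity bound the norm of [y] by that of [star y]; this is
    applied to [x] and to [star x]. *)
Lemma cnorm_star x : rnorm (star x) = rnorm x.
Proof.
have le_star y : rnorm y <= rnorm (star y).
  have [y0|y0] := eqVneq (rnorm y) 0; first by rewrite y0 rnorm_ge0.
  have := cnormM (star y) y; rewrite cnorm_sqr expr2 ler_pM2r //.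
  by rewrite lt_def y0 rnorm_ge0.
by apply/eqP; rewrite eq_le le_star -{2}(starK x) le_star.
Qed.

(** Left multiplication by the element b + a1 of the unitization, restricted to the ideal [B]. *)
Definition lmul (b : B) (a : R[i]) (c : B) : B := b ** c + a *: c.

Lemma lmul_linear b a : linear (lmul b a).
Proof.
move=> t x y; rewrite /lmul cmulDr cmulZr scalerDr scalerDr !scalerA.
by rewrite [a * t]mulrC addrACA.
Qed.

(** By the C*-identity the left side is the norm of (K + itc)^*(K + itc). Selfadjointness gives K^*c
    = c^*K, so the cross terms cancel and K^*K + t^2 c^*c remains. *)
Lemma lmul_selfadj_sqr k (r t : R) c : star k = k ->
  rnorm (lmul k (r +i* t) c) ^+ 2 <= rnorm (lmul k r%:C c) ^+ 2 + t ^+ 2 * rnorm c ^+ 2.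
Proof.
move=> kk; set K := lmul k r%:C c.
have -> : lmul k (r +i* t) c = K + (0 +i* t) *: c.
  rewrite /K /lmul -addrA -scalerDl; congr (_ + _ *: _).
  by rewrite /= -[RHS]/((_ + _) +i* _) addr0 add0r.
have Kc : star K ** c = star c ** K.
  rewrite /K /lmul starD starM starZ kk conjc_real cmulDl cmulDr cmulZl cmulZr.
  by rewrite cmulA.
move: K Kc => K Kc; rewrite -!cnorm_sqr starD starZ cmulDl !cmulDr !cmulZl !cmulZr Kc.
have -> : (0 +i* t)^*%C = - (0 +i* t) :> R[i].
  by rewrite /= -[RHS]/(_ +i* _) oppr0.
rewrite !scaleNr addrA addrK -scaleNr scalerA.
have -> : - (0 +i* t) * (0 +i* t) = (t ^+ 2)%:C :> R[i].
  by apply/eqP; rewrite eq_complex /=; apply/andP; split; apply/eqP; ring.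
apply: le_trans (rnormD _ _) _.
by rewrite rnormZr ger0_norm // sqr_ge0.
Qed.

(* Arens' trick: [k + r + is = i(s + t) + (k + r - it)], and for [t] large the
   second summand has norm at most [sqrt (m^2 + t^2) < s + t]. *)
Lemma lmul_selfadj_nonreal_surjective k (r s : R) : star k = k -> 0 < s ->
  forall y, exists c, lmul k (r +i* s) c = y.
Proof.
move=> kk s0 y.
pose m := rnorm k + `|r|.
have m0 : 0 <= m by rewrite addr_ge0 ?rnorm_ge0.
have Km c : rnorm (lmul k r%:C c) <= m * rnorm c.
  rewrite /lmul /m mulrDl; apply: le_trans (rnormD _ _) _.
  by rewrite rnormZr lerD // cnormM.
have [t [p [st0 p0 pst p2]]] := sqr_add_lt_sqr m s0.
have hP : linear (lmul k (r -i* t)) by apply: lmul_linear.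
(* Writing the scalar i(s + t) as an [lmul] with zero first argument gets its linearity from
   [lmul_linear]. *)
have hU : linear (lmul 0 (0 +i* (s + t))) by apply: lmul_linear.
have UE c : lmul 0 (0 +i* (s + t)) c = (0 +i* (s + t)) *: c.
  by rewrite /lmul cmul0x add0r.
have Unorm c : rnorm (lmul 0 (0 +i* (s + t)) c) = (s + t) * rnorm c.
  rewrite UE rnormZ normc_def /= expr0n add0r sqrtr_sqr ger0_norm //.
  exact: ltW.
have [|||c <-] := @surjective_perturbation _ _ (linear_of hU) (linear_of hP)
    (s + t) p p0 pst _ _ _ y.
- by move=> c; rewrite /= Unorm.
- move=> z; exists ((0 +i* (s + t))^-1 *: z); rewrite /= UE scalerA mulfV ?scale1r //.
  by rewrite eq_complex /= eqxx /= gt_eqF.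
- move=> c; rewrite /= -(@ler_pXn2r _ 2) ?nnegrE ?mulr_ge0 ?rnorm_ge0 //.
  apply: le_trans (lmul_selfadj_sqr _ _ _ kk) _.
  rewrite sqrrN exprMn p2 mulrDl lerD2r -exprMn.
  by rewrite ler_pXn2r ?nnegrE ?mulr_ge0 ?rnorm_ge0.
exists c; rewrite /= UE /lmul addrCA -scalerDl; congr (_ + _ *: _).
by apply/eqP; rewrite eq_complex /=; apply/andP; split; apply/eqP; ring.
Qed.

(** Write k + r as (k + r + is) - is with s = d / 4. The first term is surjective and bounded below
    by d - s, which exceeds the norm s of the second. *)
Lemma lmul_selfadj_surjective k (r d : R) : star k = k -> 0 < d ->
    (forall c, d * rnorm c <= rnorm (lmul k r%:C c)) ->
  forall y, exists c, lmul k r%:C c = y.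
Proof.
move=> kk d0 Kd y; pose s := d / 4; have s0 : 0 < s by rewrite divr_gt0.
have iE c : rnorm ((0 -i* s) *: c) = s * rnorm c.
  by rewrite rnormZ normc_def /= expr0n add0r sqrtr_sqr normrN gtr0_norm.
have hU : linear (lmul k (r +i* s)) by apply: lmul_linear.
have hP : linear (lmul 0 (0 -i* s)) by apply: lmul_linear.
have PE c : lmul 0 (0 -i* s) c = (0 -i* s) *: c by rewrite /lmul cmul0x add0r.
have KE c : lmul k (r +i* s) c + (0 -i* s) *: c = lmul k r%:C c.
  rewrite /lmul -addrA -scalerDl; congr (_ + _ *: _).
  by apply/eqP; rewrite eq_complex /=; apply/andP; split; apply/eqP; ring.
have sd : s < d - s.
  rewrite -subr_gt0 /s; suff -> : d - d / 4 - d / 4 = d / 2 by rewrite divr_gt0.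
  by field.
have [|||c <-] := @surjective_perturbation _ _ (linear_of hU) (linear_of hP)
    (d - s) s (ltW s0) sd _ _ _ y.
- move=> c /=; rewrite mulrBl -iE lerBlDr; apply: le_trans (Kd c) _.
  by rewrite -KE rnormD.
- exact: lmul_selfadj_nonreal_surjective.
- by move=> c; rewrite /= PE iE.
by exists c; rewrite /= PE KE.
Qed.

(** The part in [B] of (b + a)^*(b + a), whose scalar part is |a|^2. *)
Definition normal_coef (b : B) (a : R[i]) : B :=
  star b ** b + a *: star b + a^*%C *: b.

Lemma star_normal_coef b a : star (normal_coef b a) = normal_coef b a.
Proof.
by rewrite /normal_coef !starD starM !starZ starK conjcK addrAC.
Qed.

Lemma lmul_star_mul b a c :
  star (lmul b a c) ** lmul b a c = star c ** lmul (normal_coef b a) (a^*%C * a) c.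
Proof.
rewrite {1}/lmul starD starM starZ cmulDl -cmulA cmulZl -cmulZr -cmulDr.
congr (_ ** _); rewrite /lmul /normal_coef !cmulDl !cmulZl cmulDr cmulZr.
by rewrite scalerDr cmulA scalerA !addrA.
Qed.

(** Let N be left multiplication by (b + a)^*(b + a). The squared norm of (b + a)c is the norm of
    c^*(Nc), hence at most that of c times that of Nc; so N is bounded below by d^2, and the
    selfadjoint case applies. *)
Lemma lmul_normal_surjective b a (d : R) : 0 < d ->
    (forall c, d * rnorm c <= rnorm (lmul b a c)) ->
  forall y, exists c, lmul (normal_coef b a) (a^*%C * a) c = y.
Proof.
move=> d0 Ld.
have [r rE] : exists r : R, a^*%C * a = r%:C.
  by exists (complex.Re a ^+ 2 + complex.Im a ^+ 2); rewrite add_Re2_Im2 mulrC sqr_normc.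
have normalK c : d ^+ 2 * rnorm c <= rnorm (lmul (normal_coef b a) r%:C c).
  have [c0|c_neq0] := eqVneq (rnorm c) 0; first by rewrite c0 mulr0 rnorm_ge0.
  have c0 : 0 < rnorm c by rewrite lt_def c_neq0 rnorm_ge0.
  rewrite -(ler_pM2l c0) -rE -[X in _ <= X * _]cnorm_star.
  apply: le_trans (cnormM _ _); rewrite -lmul_star_mul cnorm_sqr mulrCA -expr2 -exprMn.
  by rewrite ler_pXn2r ?nnegrE ?mulr_ge0 ?rnorm_ge0 // ltW.
rewrite rE; apply: lmul_selfadj_surjective normalK; first exact: star_normal_coef.
exact: exprn_gt0.
Qed.

Lemma bounded_below_left_quasi_inverse b (d : R) : 0 < d ->
    (forall c, d * rnorm c <= rnorm (b ** c - c)) ->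
  exists e, qprod mul e b = 0.
Proof.
move=> d0 Ld; have [c|q] := @lmul_normal_surjective b (-1) d d0 _ (- normal_coef b (-1)).
  by rewrite /lmul scaleN1r.
have cN1 : (-1 : R[i])^*%C = -1 by apply/eqP; rewrite eq_complex /= !oppr0 !eqxx.
rewrite /lmul cN1 mulrNN mulr1 scale1r => /(congr1 star).
rewrite starN starD starM star_normal_coef => qK.
exists (star b - star q + star q ** star b).
rewrite /qprod; move: qK; rewrite /normal_coef cN1 !scaleN1r.
rewrite !cmulDr !cmulNr !cmulDl !cmulNl cmulA => qK.
apply/eqP; rewrite subr_eq0; apply/eqP.
have {qK}-> := canRL (subrK _) (canRL (subrK _) (canRL (addrK _) qK)).
rewrite !opprB !addrA.
by rewrite [RHS](ACl (4*6*8*3*(1*5)*(7*2)))%AC /= !subrr !addr0.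
Qed.

(** Left multiplication by b^*b is bijective, which forces [B] to be unital: a solution [e] of b^*b
    e = b^*b is a left unit, hence selfadjoint, hence a two-sided unit. Solving b^*b q = e and
    taking adjoints gives the left inverse q^*b^* of [b]. *)
Lemma bounded_below_left_inverse b (d : R) : 0 < d ->
    (forall c, d * rnorm c <= rnorm (b ** c)) ->
  exists e g, [/\ forall x, e ** x = x, forall x, x ** e = x & g ** b = e].
Proof.
move=> d0 Ld.
have Lb c : lmul b 0 c = b ** c by rewrite /lmul scale0r addr0.
have surj y : exists c, star b ** b ** c = y.
  have [c|c <-] := @lmul_normal_surjective b 0 d d0 _ y; first by rewrite Lb.
  by exists c; rewrite /lmul /normal_coef conjc0 mul0r !scale0r !addr0.
have inj x : b ** x = 0 -> x = 0.
  move=> bx; apply: rnorm_eq0; apply/eqP; rewrite eq_le rnorm_ge0 andbT.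
  by rewrite -(ler_pM2l d0) mulr0; have := Ld x; rewrite bx rnorm0.
have inj2 x : star b ** b ** x = 0 -> x = 0.
  move=> bx; apply: inj; apply: rnorm_eq0; apply/eqP; rewrite -sqrf_eq0 -cnorm_sqr.
  by rewrite starM -cmulA (cmulA (star b)) bx cmulx0 rnorm0.
have [e eP] := surj (star b ** b).
have ex x : e ** x = x.
  apply/eqP; rewrite -subr_eq0; apply/eqP/inj2.
  by rewrite cmulDr cmulNr cmulA eP subrr.
have ee : star e = e by rewrite -[star e]ex -{1}[e]starK -starM ex starK.
have xe x : x ** e = x by rewrite -[x]starK -ee -starM ex.
have [q qP] := surj e.
exists e, (star q ** star b); split=> //.
by rewrite -cmulA -ee -qP !starM starK.
Qed.

End Cstar.

(** * Operator algebras isomorphic to a C*-algebra *)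

Section Transfer.
Context {R : realType} {X B : completeNormedModType R[i]}.
Context {A : set (X -> X)} {mul : B -> B -> B} {phi : (X -> X) -> B}.
Hypothesis subA : subalgebra_BX A.
Hypothesis isoA : bicont_alg_iso A mul phi.

Lemma phi_inj S T : A S -> A T -> phi S = phi T -> S = T.
Proof. by case: isoA => inj _ AS AT; apply: inj; rewrite inE. Qed.

Lemma phiZ a T : A T -> phi (fun x => a *: T x) = a *: phi T.
Proof. by case: isoA => _ [_] [_] [h _]; apply: h. Qed.

Lemma phiD S T : A S -> A T -> phi (fun x => S x + T x) = phi S + phi T.
Proof. by case: isoA => _ [_] [h _]; apply: h. Qed.

Lemma phiM S T : A S -> A T -> phi (S \o T) = mul (phi S) (phi T).
Proof. by case: isoA => _ [_] [_] [_] [h _]; apply: h. Qed.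

Lemma phi0 : phi (fun=> 0) = 0.
Proof.
case: subA => _ A0 _ _ _; rewrite -[RHS](scale0r (phi (fun=> 0))) -phiZ //.
by congr phi; apply/funext => x; rewrite scale0r.
Qed.

(** Continuity at 0, applied to [S] rescaled to have bound r / 2. Any admissible bound [m] stands in
    for the operator norm. *)
Lemma phi_bounded : exists2 k : R, 0 < k & forall S (m : R), A S -> 0 <= m ->
  (forall x, rnorm (S x) <= m * rnorm x) -> rnorm (phi S) <= k * m.
Proof.
case: subA => _ A0 _ AZ _; case: isoA => _ [_] [_] [_] [_] [cphi _].
have lt01 : 0 < (1 : R)%:C by rewrite ltcR.
have [d /gt0_complexE[dE d0] hd] := cphi _ A0 _ lt01.
set r := complex.Re d in dE d0.
exists (2 / r) => [|S m AS m0 Sm]; first by rewrite divr_gt0.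
have [m_eq0|m_neq0] := eqVneq m 0.
  suff -> : S = fun=> 0 by rewrite phi0 rnorm0 m_eq0 mulr0.
  apply/funext => x; apply/rnorm_eq0/eqP; rewrite eq_le rnorm_ge0 andbT.
  by have := Sm x; rewrite m_eq0 mul0r.
have {m_neq0}m0 : 0 < m by rewrite lt_def m_neq0.
have t0 : 0 < r / (2 * m) by rewrite divr_gt0 // mulr_gt0.
have /(hd _ (AZ (r / (2 * m))%:C _ AS)) :
    opdist_lt (fun x => (r / (2 * m))%:C *: S x) (fun=> 0) d.
  exists (r / 2)%:C; rewrite dE ler0c ltcR; split; first by rewrite divr_ge0 // ltW.
  split=> [|x]; first by rewrite ltr_pdivrMr // ltr_pMr // ltr1n.
  rewrite subr0 !rnormE -rmorphM lecR rnormZr (gtr0_norm t0).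
  have -> : r / 2 * rnorm x = r / (2 * m) * (m * rnorm x).
    by field; rewrite gt_eqF.
  by rewrite ler_pM2l.
rewrite phi0 subr0 phiZ // rnormE ltcR rnormZr (gtr0_norm t0) => /ltW.
have -> : r / (2 * m) = (2 / r * m)^-1 by rewrite mulrAC invf_div.
by rewrite mulrC ler_pdivrMr ?mul1r // mulr_gt0 // divr_gt0.
Qed.

Lemma phi_inv_bounded : exists2 k : R, 0 < k & forall S x, A S ->
  rnorm (S x) <= k * rnorm (phi S) * rnorm x.
Proof.
case: subA => _ A0 _ AZ _; case: isoA => _ [_] [_] [_] [_] [_ cpsi].
have lt01 : 0 < (1 : R)%:C by rewrite ltcR.
have [d /gt0_complexE[dE d0] hd] := cpsi _ A0 _ lt01.
set r := complex.Re d in dE d0.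
exists (2 / r) => [|S x AS]; first by rewrite divr_gt0.
have [n_eq0|n_neq0] := eqVneq (rnorm (phi S)) 0.
  have -> : S = fun=> 0 by apply: phi_inj => //; rewrite phi0 (rnorm_eq0 n_eq0).
  by rewrite phi0 !rnorm0 mulr0 mul0r.
have {n_neq0}n0 : 0 < rnorm (phi S) by rewrite lt_def n_neq0 rnorm_ge0.
set n := rnorm (phi S) in n0 *.
have t0 : 0 < r / (2 * n) by rewrite divr_gt0 // mulr_gt0.
have [|m [_ [m1 /(_ x)]]] := hd _ (AZ (r / (2 * n))%:C _ AS).
  rewrite phi0 subr0 phiZ // dE rnormE ltcR rnormZr (gtr0_norm t0) -/n.
  have -> : r / (2 * n) * n = r / 2 by field; rewrite gt_eqF.
  by rewrite ltr_pdivrMr // ltr_pMr // ltr1n.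
rewrite subr0 !rnormE rnormZr (gtr0_norm t0) => h.
have {h} : (r / (2 * n) * rnorm (S x))%:C <= (1 * rnorm x)%:C.
  by apply: le_trans h _; rewrite rmorphM ler_wpM2r ?ler0c ?rnorm_ge0 // ltW.
rewrite lecR mul1r.
have -> : r / (2 * n) = (2 / r * n)^-1 by rewrite mulrAC invf_div.
by rewrite mulrC ler_pdivrMr 1?mulrC // mulr_gt0 // divr_gt0.
Qed.

(** Write [c] as [phi S]. Then (T - a)S lies in [A] even if T - a does not; its image bounds it
    pointwise, hence bounds [S] through the lower bound [d], hence bounds [c] through continuity of
    [phi]. *)
Lemma bounded_below_transfer T (a : R[i]) (d : R) : A T -> 0 < d ->
    (forall x, d * rnorm x <= rnorm (T x - a *: x)) ->
  exists2 k : R, 0 < k & forall c, k * rnorm c <= rnorm (mul (phi T) c - a *: c).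
Proof.
move=> AT d0 Td; case: subA => _ _ AD AZ AM.
have [k k0 kP] := phi_bounded; have [l l0 lP] := phi_inv_bounded.
exists (d / (k * l)) => [|c]; first by rewrite divr_gt0 // mulr_gt0.
case: isoA => _ [/(_ c)[S AS <-] _]; set y := _ - _.
have AaS : A (fun x => - a *: S x) by apply: AZ.
have ATS := AM _ _ AT AS.
have yE : phi (fun x => (T \o S) x + - a *: S x) = y.
  by rewrite phiD // phiM // phiZ // scaleNr.
have Sb x : rnorm (S x) <= l * rnorm y / d * rnorm x.
  rewrite mulrAC ler_pdivlMr // mulrC; apply: le_trans (Td _) _.
  by have := lP _ x (AD _ _ ATS AaS); rewrite yE /= scaleNr.
have ly0 : 0 <= l * rnorm y / d by rewrite divr_ge0 ?mulr_ge0 ?rnorm_ge0 // ltW.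
have h := kP S _ AS ly0 Sb.
rewrite mulrAC ler_pdivrMr ?mulr_gt0 //.
apply: le_trans (ler_wpM2l (ltW d0) h) _.
by rewrite le_eqVlt; apply/orP; left; apply/eqP; field; rewrite gt_eqF.
Qed.

End Transfer.

(** * Surjectivity from direct finiteness *)

Lemma residual_spectrum_bounded_below {R : realType} {X : completeNormedModType R[i]}
    (T : X -> X) (a : R[i]) : bounded_op T -> residual_spectrum T a ->
  exists2 d : R, 0 < d & forall x, d * rnorm x <= rnorm (T x - a *: x).
Proof.
move=> [linT contT] [inj cl _].
have linS : linear (fun x => T x - a *: x).
  move=> t u v; rewrite linT scalerDr opprD addrACA scalerBr !scalerA.
  by rewrite [a * t]mulrC.
apply: (@injective_closed_range_bounded_below _ _ _ (linear_of linS)) => // x.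
by apply: cvgB; [exact: contT | apply: cvgZr; exact: cvg_id].
Qed.

Unset Implicit Arguments.

Theorem theorem1p1 (R : realType) (X : completeNormedModType R[i])
  (A : set (X -> X)) (B : completeNormedModType R[i])
  (mul : B -> B -> B) (star : B -> B) (phi : (X -> X) -> B) :
  subalgebra_BX A -> norm_closed A ->
  is_Cstar_algebra mul star -> quasi_directly_finite mul ->
  bicont_alg_iso A mul phi ->
  surjunctive A.
Proof.
move=> subA _ Cstar qdf isoA T AT; apply/seteqP; split=> // a resa.
have [AB A0 AD AZ AM] := subA; have [linT _] := AB _ AT.
have [d d0 Td] := residual_spectrum_bounded_below (AB _ AT) resa.
have [k k0 kP] := bounded_below_transfer subA isoA AT d0 Td.
have [_ [onto _]] := isoA; have phi_inj := phi_inj isoA.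
have [injT _] := resa; apply; apply/seteqP; split=> // y _.
have T0 : T 0 = 0 by have := linT (-1) 0 0; rewrite scaler0 addr0 scaleN1r addNr.
have TZ t x : T (t *: x) = t *: T x by have := linT t x 0; rewrite T0 !addr0.
(* For nonzero [a], T - a is rescaled to 1 - a^-1 T and quasi-inverses apply directly; for [a = 0]
   the algebra first has to be shown unital. *)
have [a0|a_neq0] := eqVneq a 0.
  have T_inj x z : T x = T z -> x = z by move=> Txz; apply: injT; rewrite a0 !scale0r Txz.
  have [c|e [g [el er ge]]] := bounded_below_left_inverse Cstar (b := phi T) k0.
    by have := kP c; rewrite a0 scale0r subr0.
  (* With unit [e], the left inverse [g] of [phi T] makes [e - g] a left quasi-inverse of
     [e - phi T]; a right quasi-inverse [c] then gives the right inverse [e - c] of [phi T]. *)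
  have [|c ac] := qdf (e - phi T).
    exists (e - g); rewrite /qprod (cmulDl Cstar) !(cmulDr Cstar) !(cmulNl Cstar).
    rewrite !(cmulNr Cstar) opprK ge !el er !opprD !opprK.
    by rewrite !addrA (ACl ((1*5)*(2*7)*(3*8)*(4*6)))%AC /= !subrr !addNr !addr0.
  have [S AS Sc] := onto (e - c); have [P AP Pe] := onto e.
  (* The unit of [A] is the identity of [X], since [T \o P = T] and [T] is injective. *)
  have PE x : P x = x.
    apply: T_inj; rewrite -[LHS]/((T \o P) x); congr (_ x).
    by apply: phi_inj => //; [apply: AM | rewrite (phiM isoA) // Pe er].
  exists (S y) => //; rewrite a0 scale0r subr0 -[RHS]PE -[T (S y)]/((T \o S) y).
  congr (_ y); apply: phi_inj => //; first exact: AM.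
  rewrite (phiM isoA) // Sc Pe (cmulDr Cstar) (cmulNr Cstar) er.
  move: ac; rewrite /qprod (cmulDl Cstar) (cmulNl Cstar) el => ac.
  apply/eqP; rewrite eq_sym -subr_eq0 -[X in _ == X]ac; apply/eqP.
  by rewrite !opprD !opprK !addrA addrK.
have ra0 : 0 < complex.Re `|a^-1|.
  by rewrite -ltcR RRe_real ?normr_real // normr_gt0 invr_eq0.
have [||g gP] := bounded_below_left_quasi_inverse Cstar (b := a^-1 *: phi T)
    (d := k * complex.Re `|a^-1|).
- exact: mulr_gt0.
- move=> c; rewrite mulrAC mulrC; apply: le_trans (ler_wpM2l (ltW ra0) (kP c)) _.
  by rewrite -rnormZ scalerBr scalerA mulVf // scale1r (cmulZl Cstar).
have [|c] := qdf (a^-1 *: phi T); first by exists g.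
have [S AS <-] := onto c; rewrite /qprod => TS.
have AaT : A (fun x => a^-1 *: T x) by apply: AZ.
have ATS : A (fun x => - a^-1 *: (T \o S) x) by apply/AZ/AM.
have /(congr1 (fun f => f y))/= TSy :
    (fun x => a^-1 *: T x + S x + - a^-1 *: (T \o S) x) = fun=> 0.
  apply: phi_inj => //; first by apply: (AD _ _ (AD _ _ AaT AS)).
  rewrite (phiD isoA (AD _ _ AaT AS) ATS) (phiD isoA AaT AS) (phi0 subA isoA).
  rewrite (phiZ isoA _ AT) (phiZ isoA _ (AM _ _ AT AS)) (phiM isoA AT AS).
  by rewrite -[RHS]TS (cmulZl Cstar) scaleNr.
(* The identity [TSy] says (1 - a^-1 T)(1 - S)y = y, and the left side is T - a applied to this
   vector. *)
exists (a^-1 *: (S y - y)) => //.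
have TB u v : T (u - v) = T u - T v.
  by rewrite -[- v]scaleN1r addrC linT scaleN1r addrC.
rewrite TZ TB scalerA mulfV // scale1r opprB scalerBr -[RHS]subr0 -TSy scaleNr.
by rewrite !opprD opprK !addrA [LHS](ACl (3*2*4*1))%AC.
Qed.
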